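(* Let $T$ be an $n\times n$ real symmetric tridiagonal matrix with characteristic polynomial $\det(\lambda I-T)=\lambda^n+c_1\lambda^{n-1}+\cdots+c_{n-1}\lambda+c_n$, let $1\le k\le n$, and assume the floating point assumptions stated in the context. Let $\mathrm{fl}[c_j]=\hat c_j^{(n)}$, $1\le j\le k$, be the leading $k$ coefficients computed in floating point arithmetic by La Budde's method for symmetric tridiagonal matrices (the recursion in the context), and let $\phi_j$ be the running error bounds defined in the context. Then $$|\mathrm{fl}[c_j]-c_j|\leq \phi_j,\qquad 1\leq j\leq k.$$
   Context: $T$ has diagonal elements $\alpha_1,\ldots,\alpha_n$ and off-diagonal elements $\beta_2,\ldots,\beta_n$ ($\beta_i$ in positions $(i-1,i)$ and $(i,i-1)$). Floating point assumptions: all matrix elements are normalized real floating point numbers; $u$ is the unit roundoff and $nu<1$; no operation underflows or overflows; $\mathrm{fl}[\cdot]$ denotes the result computed in floating point arithmetic (a product of three numbers such as $\beta_i^2\hat c$ is computed by two successive floating point multiplications). For $\mathrm{op}\in\{+,-,\times,/\}$ and normalized real floating point numbers $x,y$ such that $x\ \mathrm{op}\ y$ does not underflow or overflow, $\mathrm{fl}[x\ \mathrm{op}\ y]=(x\ \mathrm{op}\ y)(1+\delta)$ for some $|\delta|\le u$, and also $\mathrm{fl}[x\ \mathrm{op}\ y]=(x\ \mathrm{op}\ y)/(1+\epsilon)$ for some $|\epsilon|\le u$. $\gamma_m=\frac{mu}{1-mu}$. Computed recursion (for $j\le k$): $\hat c_1^{(1)}=-\alpha_1$ (exact); $\hat{c}_1^{(i)}=\mathrm{fl}[\hat{c}_1^{(i-1)}-\alpha_i]$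 for $2\le i\le n$; $\hat c_2^{(2)}=\mathrm{fl}[\mathrm{fl}[\alpha_1\alpha_2]-\mathrm{fl}[\beta_2^2]]$; $\hat c_2^{(i)}=\mathrm{fl}[\mathrm{fl}[\hat c_2^{(i-1)}-\mathrm{fl}[\alpha_i\hat c_1^{(i-1)}]]-\mathrm{fl}[\beta_i^2]]$ for $3\le i\le n$; $\hat c_i^{(i)}=-\mathrm{fl}[\mathrm{fl}[\alpha_i\hat c_{i-1}^{(i-1)}]+\mathrm{fl}[\beta_i^2\hat c_{i-2}^{(i-2)}]]$ for $3\le i\le k$; $\hat c_j^{(i)}=\mathrm{fl}[\mathrm{fl}[\hat{c}_j^{(i-1)}-\mathrm{fl}[\alpha_i\hat c_{j-1}^{(i-1)}]]-\mathrm{fl}[\beta_i^2\hat c_{j-2}^{(i-2)}]]$ for $3\le j\le k$, $j+1\le i\le n$. Running error bounds: define nonnegative numbers $\phi_j^{(i)}$ (bounding the errors of the $\hat c_j^{(i)}$ as approximations of the corresponding exact coefficients of the leading principal submatrix of order $i$) by $\phi_1^{(1)}=0$; $\phi_1^{(i)}=\phi_1^{(i-1)}+u|\hat c_1^{(i)}|$ for $2\le i\le n$; $\phi_2^{(2)}=u(|\alpha_2\alpha_1|+|\beta_2^2|+|\hat c_2^{(2)}|)$; $\phi_2^{(i)}=\phi_2^{(i-1)}+|\alpha_i|\phi_1^{(i-1)}+u(|\hat c_2^{(i-1)}|+|\beta_i^2|+|\hat c_2^{(i)}|)+\gamma_2|\alpha_i\hat c_1^{(i-1)}|$ for $3\le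 i\le n$; $\phi_i^{(i)}=|\alpha_i|\phi_{i-1}^{(i-1)}+\beta_i^2\phi_{i-2}^{(i-2)}+u(|\alpha_i\hat c_{i-1}^{(i-1)}|+|\hat c_i^{(i)}|)+\gamma_2|\beta_i^2\hat c_{i-2}^{(i-2)}|$ for $3\le i\le k$; $\phi_j^{(i)}=\phi_j^{(i-1)}+|\alpha_i|\phi_{j-1}^{(i-1)}+\beta_i^2\phi_{j-2}^{(i-2)}+u(|\hat c_j^{(i-1)}|+|\hat c_j^{(i)}|)+\gamma_2(|\alpha_i\hat c_{j-1}^{(i-1)}|+|\beta_i^2\hat c_{j-2}^{(i-2)}|)$ for $3\le j\le k$, $j+1\le i\le n$. Finally $\phi_j=\phi_j^{(n)}$ for $1\le j\le k$. *)

(* Defs.v *)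
From mathcomp Require Import all_boot all_order all_algebra.
From mathcomp Require Import reals.
Set Implicit Arguments.
Unset Strict Implicit.
Unset Printing Implicit Defensive.
Import Order.TTheory GRing.Theory Num.Theory.
Local Open Scope ring_scope.

Inductive fpop := FAdd | FSub | FMul | FDiv.

Definition exact_op (R : realType) (o : fpop) (x y : R) : R :=
  match o with
  | FAdd => x + y
  | FSub => x - y
  | FMul => x * y
  | FDiv => x / y
  end.

(* The standard axiomatic model of floating point arithmetic: the format, the
   rounding and the criteria for underflow and overflow are left unspecified.
   As is customary, 0 counts as a normalized number, so an exact cancellation
   need not be an underflow.  The guard on FDiv is needed because x / 0 = 0 in
   R, whereas a division by zero has no floating point result. *)
Record fparith (R : realType) := FPArith {
  normalized : R -> Prop;
  roundoff : R;
  underflows : fpop -> R -> R -> Prop;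
  overflows : fpop -> R -> R -> Prop;
  fl : fpop -> R -> R -> R;
  no_exception (o : fpop) (x y : R) :=
    [/\ ~ underflows o x y, ~ overflows o x y & o = FDiv -> y != 0];
  roundoff_gt0 : 0 < roundoff;
  normalized0 : normalized 0;
  normalizedN : forall x, normalized x -> normalized (- x);
  normalized_fl : forall o x y, normalized x -> normalized y ->
    no_exception o x y -> normalized (fl o x y);
  fl_mul : forall o x y, normalized x -> normalized y ->
    no_exception o x y ->
    exists2 delta, `|delta| <= roundoff &
      fl o x y = exact_op o x y * (1 + delta);
  fl_div : forall o x y, normalized x -> normalized y ->
    no_exception o x y ->
    exists2 epsilon, `|epsilon| <= roundoff &
      fl o x y = exact_op o x y / (1 + epsilon)
}.

Definition gamma (R : realType) (A : fparith R) (m : nat) : R :=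
  m%:R * roundoff A / (1 - m%:R * roundoff A).

(* Arithmetic expressions, so that the value computed in floating point and
   the absence of exceptions refer to the same sequence of operations.
   A change of sign is exact. *)
Inductive fpexpr (R : realType) :=
  | FpVal of R
  | FpNeg of fpexpr R
  | FpOp of fpop & fpexpr R & fpexpr R.

Declare Scope fpexpr_scope.
Delimit Scope fpexpr_scope with fpe.
Bind Scope fpexpr_scope with fpexpr.
Reserved Notation "x %:fp" (at level 1, left associativity, format "x %:fp").
Notation "x %:fp" := (FpVal x) : fpexpr_scope.
Notation "- e" := (FpNeg e) : fpexpr_scope.
Notation "e1 + e2" := (FpOp FAdd e1 e2) : fpexpr_scope.
Notation "e1 - e2" := (FpOp FSub e1 e2) : fpexpr_scope.
Notation "e1 * e2" := (FpOp FMul e1 e2) : fpexpr_scope.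

Fixpoint fl_eval (R : realType) (A : fparith R) (e : fpexpr R) : R :=
  match e with
  | FpVal x => x
  | FpNeg e1 => - fl_eval A e1
  | FpOp o e1 e2 => fl A o (fl_eval A e1) (fl_eval A e2)
  end.

Fixpoint fl_safe (R : realType) (A : fparith R) (e : fpexpr R) : Prop :=
  match e with
  | FpVal _ => True
  | FpNeg e1 => fl_safe A e1
  | FpOp o e1 e2 => [/\ fl_safe A e1, fl_safe A e2
                      & no_exception A o (fl_eval A e1) (fl_eval A e2)]
  end.

Definition tridiagonal (R : realType) (n : nat) (T : 'M[R]_n) : Prop :=
  forall i j : 'I_n, (i.+1 < j)%N || (j.+1 < i)%N -> T i j = 0.

(* All indices are 1-based.  The expression for the coefficient of index j of
   the leading principal submatrix of order i, where c1 and c2 hold the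
   coefficients computed at orders i - 1 and i - 2.  Only 1 <= j <= i is
   meaningful. *)
Definition labudde_expr (R : realType) (alpha beta : nat -> R) (i j : nat)
    (c1 c2 : nat -> R) : fpexpr R :=
  let a := (alpha i)%:fp%fpe in
  let b := (beta i)%:fp%fpe in
  (match j with
   | 0 => 0%:fp
   | 1 => if i == 1%N then - a else (c1 1%N)%:fp - a
   | 2 => if i == 2%N then (alpha 1%N)%:fp * a - b * b
          else (c1 2%N)%:fp - a * (c1 1%N)%:fp - b * b
   | _ => if i == j then - (a * (c1 j.-1)%:fp + b * b * (c2 j.-2)%:fp)
          else (c1 j)%:fp - a * (c1 j.-1)%:fp - b * b * (c2 j.-2)%:fp
   end)%fpe.

Fixpoint chat (R : realType) (A : fparith R) (alpha beta : nat -> R)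
    (i j : nat) {struct i} : R :=
  if i is i1.+1 then
    fl_eval A (labudde_expr alpha beta i j
                 (chat A alpha beta i1) (chat A alpha beta i1.-1))
  else 0.

Definition labudde_safe (R : realType) (A : fparith R) (alpha beta : nat -> R)
    (n k : nat) : Prop :=
  forall i j : nat, (1 <= j <= k)%N -> (j <= i <= n)%N ->
    fl_safe A (labudde_expr alpha beta i j
                 (chat A alpha beta i.-1) (chat A alpha beta i.-2)).

Fixpoint phi (R : realType) (A : fparith R) (alpha beta : nat -> R)
    (i j : nat) {struct i} : R :=
  if i is i1.+1 then
    let u := roundoff A in
    let g2 := gamma A 2 in
    let a := alpha i in
    let b := beta i in
    let c := chat A alpha beta i in
    let c1 := chat A alpha beta i.-1 in
    let c2 := chat A alpha beta i.-2 in
    let phi1 := phi A alpha beta i1 in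
    let phi2 := phi A alpha beta i1.-1 in
    match j with
    | 0 => 0
    | 1 => if i == 1%N then 0 else phi1 1%N + u * `|c 1%N|
    | 2 => if i == 2%N then
             u * (`|a * alpha 1%N| + `|b ^+ 2| + `|c 2%N|)
           else
             phi1 2%N + `|a| * phi1 1%N
             + u * (`|c1 2%N| + `|b ^+ 2| + `|c 2%N|)
             + g2 * `|a * c1 1%N|
    | _ => if i == j then
             `|a| * phi1 j.-1 + b ^+ 2 * phi2 j.-2
             + u * (`|a * c1 j.-1| + `|c j|)
             + g2 * `|b ^+ 2 * c2 j.-2|
           else
             phi1 j + `|a| * phi1 j.-1 + b ^+ 2 * phi2 j.-2
             + u * (`|c1 j| + `|c j|)
             + g2 * (`|a * c1 j.-1| + `|b ^+ 2 * c2 j.-2|)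
    end
  else 0.

(* Main.v *)
(** The two forms of the rounding model bound the error of one operation
    relative to its exact result ([fl_err_exact]) and to its computed result
    ([fl_err_computed]).  Expanding [det (X - T)] along its last row gives the
    three-term recurrence of the characteristic polynomials of the leading
    principal submatrices, of which La Budde's recursion is the coefficientwise
    form.  The bound follows by induction on the order: the last operation of a
    step is charged to its computed result, the others to their exact results,
    and two roundings in a row cost [(1 + u)^2 - 1 <= gamma_2]. *)
Require Import Defs.
From mathcomp Require Import all_boot all_order all_algebra.
From mathcomp Require Import reals.
From mathcomp Require Import ring lra zify.
Set Implicit Arguments.
Unset Strict Implicit.
Unset Printing Implicit Defensive.
Import Order.TTheory GRing.Theory Num.Theory.
Local Open Scope ring_scope.

(** * Determinants of tridiagonal matrices *)

Section TridiagonalDeterminant.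
Variables (R : comNzRingType) (a b c : nat -> R).

(** The ring is arbitrary so that the entries can later be polynomials. *)
Definition tridiag_mx n : 'M[R]_n := \matrix_(i, j)
  if i == j :> nat then a i else if j == i.+1 :> nat then b j
  else if i == j.+1 :> nat then c i else 0.

Lemma det_tridiag_mx n :
  \det (tridiag_mx n.+2) =
  a n.+1 * \det (tridiag_mx n.+1) - b n.+1 * c n.+1 * \det (tridiag_mx n).
Proof.
have bumpE m i : (i < m)%N -> bump m i = i by rewrite /bump => lt_im; lia.
have [p pE] : exists p : 'I_n.+2, p = n :> nat.
  by exists (inord n); rewrite inordK.
have sign_even m : (-1) ^+ (m + m) = 1 :> R.
  by rewrite addnn -mul2n exprM sqrrN !expr1n.
rewrite (expand_det_row _ ord_max) (bigD1 ord_max) //= (bigD1 p) /=; last first.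
  by rewrite -val_eqE /= pE; lia.
rewrite [X in _ + (_ + X)]big1 ?addr0; last first.
  case=> i lt_i /andP[]; rewrite -!val_eqE /= pE => i_neq_max i_neq_p.
  by rewrite mxE /= !ifF ?mul0r //; lia.
rewrite !mxE /= pE !eqxx /= !ifF; [|lia..].
rewrite /cofactor.
have -> : row' ord_max (col' ord_max (tridiag_mx n.+2)) = tridiag_mx n.+1.
  by apply/matrixP=> i j; rewrite !mxE /= !bumpE.
rewrite sign_even mul1r; congr (_ + _).
(* In the minor of the subdiagonal entry, the last column has at most one nonzero entry,
   [b n.+1]. *)
rewrite (expand_det_col _ ord_max) (bigD1 ord_max) //= big1 ?addr0; last first.
  move=> i; rewrite -val_eqE /= => i_neq_max.
  have lt_i := ltn_ord i.
  by rewrite !mxE /= pE /bump !ifF ?mul0r //; lia.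
rewrite /cofactor.
have -> : row' ord_max (col' ord_max
    (row' ord_max (col' p (tridiag_mx n.+2)))) = tridiag_mx n.
  apply/matrixP=> i j; rewrite !mxE /= pE.
  by rewrite !(bumpE n) // bumpE // ltnS ltnW.
rewrite !mxE /= pE bumpE // /bump leqnn add1n eqxx ifF; last by lia.
rewrite addSn exprS !sign_even.
by ring.
Qed.

End TridiagonalDeterminant.

(** * Coefficient recurrences for the characteristic polynomials *)

Section TridiagonalCharPoly.
Variables (R : comNzRingType) (alpha beta : nat -> R).

(* As in the paper, [alpha] and [beta] are indexed from 1 and [beta i] is at
   positions [(i - 1, i)] and [(i, i - 1)]; [beta 1] is not used. *)
Definition jacobi_mx n : 'M[R]_n :=
  tridiag_mx (fun i => alpha i.+1) (fun i => beta i.+1) (fun i => beta i.+1) n.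

(** The characteristic matrix is again tridiagonal, over polynomials; its negated off-diagonal
    entries enter only through products of two, where the signs cancel. *)
Lemma char_poly_jacobi_mx n :
  char_poly (jacobi_mx n.+2) =
  ('X - (alpha n.+2)%:P) * char_poly (jacobi_mx n.+1)
  - (beta n.+2 ^+ 2)%:P * char_poly (jacobi_mx n).
Proof.
have E m : char_poly (jacobi_mx m) =
    \det (tridiag_mx (fun i => 'X - (alpha i.+1)%:P)
       (fun i => - (beta i.+1)%:P) (fun i => - (beta i.+1)%:P) m).
  congr (\det _); apply/matrixP=> i j; rewrite !mxE -val_eqE.
  case: (val i =P val j) => [->|_]; first by rewrite mulr1n.
  by rewrite mulr0n sub0r; do 2?case: ifP => _; rewrite ?polyC0 ?oppr0.
by rewrite !E det_tridiag_mx mulrNN -expr2 -rmorphXn.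
Qed.

(* Meaningful only for [j <= i], the subtraction being truncated. *)
Definition char_coef i j := (char_poly (jacobi_mx i))`_(i - j).

Lemma char_coef0 i : char_coef i 0 = 1.
Proof.
have /monicP := char_poly_monic (jacobi_mx i).
by rewrite /char_coef subn0 lead_coefE size_char_poly.
Qed.

Lemma char_coef11 : char_coef 1 1 = - alpha 1.
Proof.
rewrite /char_coef char_poly_trace // /mxtrace big_ord1.
by rewrite mxE.
Qed.

Lemma char_coef1 i : char_coef i.+2 1 = char_coef i.+1 1 - alpha i.+2.
Proof.
rewrite /char_coef !subSS !subn0 char_poly_jacobi_mx mulrBl !coefB.
rewrite coefXM !coefCM.
have := char_coef0 i.+1; rewrite /char_coef subn0 => -> /=.
(* The polynomial of order [i] has degree [i], hence coefficient 0 at [i.+1]. *)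
rewrite mulr1 (nth_default 0 (_ : size _ <= i.+1)%N) ?size_char_poly //.
by rewrite mulr0 subr0.
Qed.

Lemma char_coef_diag i :
  char_coef i.+2 i.+2 =
  - (alpha i.+2 * char_coef i.+1 i.+1 + beta i.+2 ^+ 2 * char_coef i i).
Proof.
rewrite /char_coef !subnn char_poly_jacobi_mx mulrBl !coefB coefXM !coefCM /=.
by rewrite sub0r opprD.
Qed.

(** Since [j < i], the degree [i - j] is positive and the factor ['X] shifts it by one; at degree 0
    that term vanishes, which is the case of [char_coef_diag]. *)
Lemma char_coef_rec i j : (j < i)%N ->
  char_coef i.+2 j.+2 =
  char_coef i.+1 j.+2 - alpha i.+2 * char_coef i.+1 j.+1
  - beta i.+2 ^+ 2 * char_coef i j.
Proof.
move=> lt_ji; rewrite /char_coef !subSS char_poly_jacobi_mx mulrBl !coefB.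
by rewrite coefXM !coefCM subn_eq0 leqNgt lt_ji /= subnS.
Qed.

End TridiagonalCharPoly.

(** * Rounding errors of one or two operations *)

Section FloatingPointErrors.
Variables (R : realType) (A : fparith R).
Local Notation u := (roundoff A).
Local Notation normal := (normalized A).

Lemma fl_err_exact o x y : normal x -> normal y -> no_exception A o x y ->
  `|fl A o x y - exact_op o x y| <= u * `|exact_op o x y|.
Proof.
move=> nx ny nexc; have [d d_le ->] := fl_mul nx ny nexc.
by rewrite mulrDr mulr1 addrAC subrr add0r normrM mulrC ler_wpM2r.
Qed.

Lemma fl_err_computed o x y : u < 1 ->
  normal x -> normal y -> no_exception A o x y ->
  `|fl A o x y - exact_op o x y| <= u * `|fl A o x y|.
Proof.
move=> u_lt1 nx ny nexc; have [e e_le flE] := fl_div nx ny nexc.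
have e_neq : 1 + e != 0.
  by apply/eqP=> e0; move: e_le; rewrite ler_norml => /andP[]; lra.
have -> : exact_op o x y = fl A o x y * (1 + e) by rewrite flE divfK.
rewrite mulrDr mulr1 opprD addrA subrr sub0r normrN normrM mulrC.
by rewrite ler_wpM2r.
Qed.

(** Clearing the denominator leaves [2u - 3u^2 - 2u^3 <= 2u]. *)
Lemma two_roundings_gamma2 : 2%:R * u < 1 -> 2 * u + u ^+ 2 <= gamma A 2.
Proof.
move=> u_lt; have u_gt0 := roundoff_gt0 A.
by rewrite /gamma ler_pdivlMr; nra.
Qed.

(** With [q] the rounded product, the subtraction errs by at most
    [u |x - q| <= u |x| + u (1 + u) |a y|], and the product adds [u |a y|]. *)
Lemma err_fl_sub_mul x a y :
  2%:R * u < 1 -> normal x -> normal a -> normal y ->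
  no_exception A FMul a y -> no_exception A FSub x (fl A FMul a y) ->
  `|fl A FSub x (fl A FMul a y) - (x - a * y)|
    <= u * `|x| + gamma A 2 * `|a * y|.
Proof.
move=> u_lt nx na ny ey es.
have /= := fl_err_exact na ny ey.
have /= := fl_err_exact nx (normalized_fl na ny ey) es.
set t := fl A FSub _ _; set q := fl A FMul _ _ => err_t err_q.
have := ler_wpM2r (normr_ge0 (a * y)) (two_roundings_gamma2 u_lt).
have := ler_normB x q; have := lerB_dist q (a * y).
have := ler_distD (x - q) t (x - a * y).
have -> : x - q - (x - a * y) = - (q - a * y) by ring.
rewrite normrN => *; have := roundoff_gt0 A; nra.
Qed.

Lemma err_fl_sqr_mul b y :
  2%:R * u < 1 -> normal b -> normal y ->
  no_exception A FMul b b -> no_exception A FMul (fl A FMul b b) y ->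
  `|fl A FMul (fl A FMul b b) y - b ^+ 2 * y| <= gamma A 2 * `|b ^+ 2 * y|.
Proof.
move=> u_lt nb ny eb ey.
have /= := fl_err_exact nb nb eb.
have /= := fl_err_exact (normalized_fl nb nb eb) ny ey.
set t := fl A FMul _ _; set q := fl A FMul b b => err_t err_q.
have := ler_wpM2r (normr_ge0 (b ^+ 2 * y)) (two_roundings_gamma2 u_lt).
(* Exact multiplication by [y] preserves the relative error of the first rounding. *)
have : `|q * y - b ^+ 2 * y| <= u * `|b ^+ 2 * y|.
  by rewrite -mulrBl !(normrM _ y) mulrA ler_wpM2r.
have := lerB_dist (q * y) (b ^+ 2 * y).
have := ler_distD (q * y) t (b ^+ 2 * y).
move=> *; have := roundoff_gt0 A; nra.
Qed.

Lemma err_scale (a x x' e : R) : `|x - x'| <= e ->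
  `|a * x - a * x'| <= `|a| * e.
Proof. by move=> le_e; rewrite -mulrBr normrM ler_wpM2l. Qed.

Lemma err_scale_sqr (b x x' e : R) : `|x - x'| <= e ->
  `|b ^+ 2 * x - b ^+ 2 * x'| <= b ^+ 2 * e.
Proof. by move/(err_scale (b ^+ 2)); rewrite (ger0_norm (sqr_ge0 b)). Qed.

(** * Error propagation through one step of the recursion *)

Section ErrorPropagation.
Hypothesis u_lt1 : u < 1.

Lemma err_sub x x' ex a : normal x -> normal a -> `|x - x'| <= ex ->
  let e := (x%:fp - a%:fp)%fpe in
  fl_safe A e ->
  `|fl_eval A e - (x' - a)| <= ex + u * `|fl_eval A e|.
Proof.
move=> nx na le_x /= [_ _ ez].
have /= := fl_err_computed u_lt1 nx na ez.
have := ler_distD (x - a) (fl A FSub x a) (x' - a).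
have -> : x - a - (x' - a) = x - x' by ring.
by lra.
Qed.

(** The operands are input data, so no error is inherited; each product is rounded once before the
    subtraction, hence no [gamma]. *)
Lemma err_det2 a1 a2 b : normal a1 -> normal a2 -> normal b ->
  let e := (a1%:fp * a2%:fp - b%:fp * b%:fp)%fpe in
  fl_safe A e ->
  `|fl_eval A e - (a1 * a2 - b ^+ 2)|
    <= u * (`|a2 * a1| + `|b ^+ 2| + `|fl_eval A e|).
Proof.
move=> n1 n2 nb /= [[_ _ ep] [_ _ eq] ez].
have np := normalized_fl n1 n2 ep; have nq := normalized_fl nb nb eq.
have /= := fl_err_computed u_lt1 np nq ez.
have /= := fl_err_exact nb nb eq; have /= := fl_err_exact n1 n2 ep.
(* With two-sided bounds and [u] distributed over sums, the goal is linear in the remaining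
   products. *)
rewrite -expr2 [a2 * a1]mulrC !ler_norml !mulrDr.
set z := fl A FSub _ _; set p := fl A FMul _ _; set q := fl A FMul _ _.
by do 3![case/andP=> ? ?]; apply/andP; split; lra.
Qed.

Hypothesis u2_lt1 : 2%:R * u < 1.

(** Before the last subtraction [x] and [b ^+ 2] are rounded once, [a * y] twice. *)
Lemma err_step2 x a y b x' y' ex ey :
  normal x -> normal a -> normal y -> normal b ->
  `|x - x'| <= ex -> `|y - y'| <= ey ->
  let e := (x%:fp - a%:fp * y%:fp - b%:fp * b%:fp)%fpe in
  fl_safe A e ->
  `|fl_eval A e - (x' - a * y' - b ^+ 2)|
    <= ex + `|a| * ey + u * (`|x| + `|b ^+ 2| + `|fl_eval A e|)
       + gamma A 2 * `|a * y|.
Proof.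
move=> nx na ny nb le_x /(err_scale a) le_y /= [[_ [_ _ ep] et] [_ _ eq] ez].
have nt := normalized_fl nx (normalized_fl na ny ep) et.
have /= := fl_err_computed u_lt1 nt (normalized_fl nb nb eq) ez.
have /= := fl_err_exact nb nb eq.
have := err_fl_sub_mul u2_lt1 nx na ny ep et.
move: le_x le_y; rewrite -expr2 !ler_norml !mulrDr.
set z := fl A FSub _ (fl A _ _ _); set q := fl A FMul b b.
set t := fl A FSub _ _.
by do 5![case/andP=> ? ?]; apply/andP; split; lra.
Qed.

(** Before the addition only the triple product is rounded twice, so [a * y] keeps the factor
    [u]. *)
Lemma err_diag a y b w y' w' ey ew :
  normal a -> normal y -> normal b -> normal w ->
  `|y - y'| <= ey -> `|w - w'| <= ew ->
  let e := (- (a%:fp * y%:fp + b%:fp * b%:fp * w%:fp))%fpe in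
  fl_safe A e ->
  `|fl_eval A e - - (a * y' + b ^+ 2 * w')|
    <= `|a| * ey + b ^+ 2 * ew + u * (`|a * y| + `|fl_eval A e|)
       + gamma A 2 * `|b ^+ 2 * w|.
Proof.
move=> na ny nb nw /(err_scale a) le_y /(err_scale_sqr b) le_w /=.
move=> [[_ _ ep] [[_ _ eb] _ eq] ez].
have nb2 := normalized_fl nb nb eb.
have /= := fl_err_computed u_lt1 (normalized_fl na ny ep)
  (normalized_fl nb2 nw eq) ez.
have /= := fl_err_exact na ny ep.
have := err_fl_sqr_mul u2_lt1 nb nw eb eq.
move: le_y le_w; rewrite normrN !ler_norml !mulrDr.
set z := fl A FAdd _ _; set q := fl A FMul (fl A _ _ _) _.
set p := fl A FMul _ _.
by do 5![case/andP=> ? ?]; apply/andP; split; lra.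
Qed.

Lemma err_step x a y b w x' y' w' ex ey ew :
  normal x -> normal a -> normal y -> normal b -> normal w ->
  `|x - x'| <= ex -> `|y - y'| <= ey -> `|w - w'| <= ew ->
  let e := (x%:fp - a%:fp * y%:fp - b%:fp * b%:fp * w%:fp)%fpe in
  fl_safe A e ->
  `|fl_eval A e - (x' - a * y' - b ^+ 2 * w')|
    <= ex + `|a| * ey + b ^+ 2 * ew + u * (`|x| + `|fl_eval A e|)
       + gamma A 2 * (`|a * y| + `|b ^+ 2 * w|).
Proof.
move=> nx na ny nb nw le_x /(err_scale a) le_y /(err_scale_sqr b) le_w /=.
move=> [[_ [_ _ ep] et] [[_ _ eb] _ eq] ez].
have nb2 := normalized_fl nb nb eb.
have nt := normalized_fl nx (normalized_fl na ny ep) et.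
have /= := fl_err_computed u_lt1 nt (normalized_fl nb2 nw eq) ez.
have := err_fl_sqr_mul u2_lt1 nb nw eb eq.
have := err_fl_sub_mul u2_lt1 nx na ny ep et.
move: le_x le_y le_w; rewrite !ler_norml !mulrDr.
set z := fl A FSub _ (fl A _ _ _); set q := fl A FMul (fl A _ _ _) _.
set t := fl A FSub _ _.
by do 6![case/andP=> ? ?]; apply/andP; split; lra.
Qed.

End ErrorPropagation.

(** [fl_safe] constrains only the operations; this covers the leaves. *)
Fixpoint inputs_normalized (e : fpexpr R) : Prop :=
  match e with
  | FpVal x => normal x
  | FpNeg e1 => inputs_normalized e1
  | FpOp _ e1 e2 => inputs_normalized e1 /\ inputs_normalized e2
  end.

Lemma normalized_fl_eval e :
  inputs_normalized e -> fl_safe A e -> normal (fl_eval A e).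
Proof.
elim: e => [x|e IHe|o e1 IH1 e2 IH2] //=.
  by move=> /IHe IH /IH; apply: normalizedN.
by move=> [/IH1 n1 /IH2 n2] [/n1 ? /n2 ?]; apply: normalized_fl.
Qed.

End FloatingPointErrors.

(** * Induction on the order for La Budde's recursion *)

Section LaBudde.
Variables (R : realType) (A : fparith R) (alpha beta : nat -> R) (n k : nat).
Local Notation u := (roundoff A).
Local Notation normal := (normalized A).
Local Notation chat := (chat A alpha beta).
Local Notation phi := (phi A alpha beta).
Local Notation char_coef := (char_coef alpha beta).

Hypothesis alpha_normalized : forall i, (0 < i <= n)%N -> normal (alpha i).
Hypothesis beta_normalized : forall i, (1 < i <= n)%N -> normal (beta i).
Hypothesis nu_lt1 : n%:R * u < 1.
Hypothesis no_exc : labudde_safe A alpha beta n k.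

Lemma small_roundoff m : (m <= n)%N -> m%:R * u < 1.
Proof.
move=> le_mn; apply: le_lt_trans nu_lt1.
by rewrite ler_wpM2r ?ler_nat // ltW ?roundoff_gt0.
Qed.

Lemma chat_normalized i j :
  (1 <= j <= k)%N -> (j <= i <= n)%N -> normal (chat i j).
Proof.
elim/ltn_ind: i j => -[|i] IH j j_range i_range; first by lia.
apply: normalized_fl_eval (no_exc j_range i_range).
have na : normal (alpha i.+1) by apply: alpha_normalized; lia.
have c1 m : (0 < m <= k)%N -> (m <= i)%N -> normal (chat i m).
  by move=> *; apply: IH; lia.
(* For [i = 0] there is no order two below, and the two ranges of [m] are contradictory. *)
have c2 m : (0 < m <= k)%N -> (m <= i.-1)%N -> normal (chat i.-1 m).
  by move=> *; apply: IH; lia.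
case: j j_range i_range => [|[|[|j]]] j_range i_range /=; first by lia.
- by case: eqP => ? //=; split => //; apply: c1; lia.
(* [beta] is known to be normalized only from index 2 on, which [2 <= j] now guarantees. *)
- have nb : normal (beta i.+1) by apply: beta_normalized; lia.
  case: eqP => ? /=; first by split; split => //; apply: alpha_normalized; lia.
  by do !split => //; apply: c1; lia.
have nb : normal (beta i.+1) by apply: beta_normalized; lia.
case: eqP => ? /=; first by do !split => //; (apply: c1 || apply: c2); lia.
by do !split => //; (apply: c1 || apply: c2); lia.
Qed.

(** Strong induction, since orders [i - 1] and [i - 2] both occur; in each branch beyond order 1 the
    matching propagation lemma yields the defining formula of [phi]. *)
Lemma chat_err i j : (1 <= j <= k)%N -> (j <= i <= n)%N ->
  `|chat i j - char_coef i j| <= phi i j.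
Proof.
elim/ltn_ind: i j => i IH j j_range i_range.
have /= := no_exc j_range i_range.
have u_lt1 : u < 1 by have := @small_roundoff 1; rewrite mul1r; apply; lia.
have na : normal (alpha i) by apply: alpha_normalized; lia.
case: i IH i_range na => [|[|i]] IH i_range na; first by lia.
  have -> : j = 1%N by lia.
  by rewrite char_coef11 /= subrr normr0.
have nb : normal (beta i.+2) by apply: beta_normalized; lia.
have c1 m : (0 < m <= k)%N -> (m <= i.+1)%N -> normal (chat i.+1 m).
  by move=> *; apply: chat_normalized; lia.
have c2 m : (0 < m <= k)%N -> (m <= i)%N -> normal (chat i m).
  by move=> *; apply: chat_normalized; lia.
case: j j_range i_range => [|[|[|j]]] j_range i_range; first by lia.
- rewrite char_coef1 => safe.
  by apply: (err_sub u_lt1 (c1 1%N _ _) na (IH i.+1 _ 1%N _ _) safe); lia.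
(* Index 2 is the instance [0] of the recurrence, where [beta ^+ 2] multiplies a leading coefficient
   1. It requires [0 < i], so order 2 is treated as diagonal. *)
- have := @char_coef_rec _ alpha beta i 0.
  case: i => [|i] in IH i_range na nb c1 c2 *.
    rewrite (char_coef_diag alpha beta 0) char_coef11 char_coef0 => _ safe.
    rewrite mulr1 mulrN opprD opprK [alpha 2 * _]mulrC.
    by apply: err_det2 => //; apply: alpha_normalized; lia.
  rewrite char_coef0 mulr1 => -> // safe.
  by apply: (err_step2 u_lt1 (small_roundoff _) (c1 2%N _ _) na (c1 1%N _ _) nb
    (IH i.+2 _ 2%N _ _) (IH i.+2 _ 1%N _ _) safe); lia.
have u2_lt1 : 2%:R * u < 1 by apply: small_roundoff; lia.
have [eq_ij|neq_ij] := eqVneq i.+2 j.+3.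
  have {}eq_ij : i = j.+1 by lia.
  rewrite {}eq_ij in IH i_range na nb c1 c2 *.
  rewrite /= eqxx char_coef_diag => safe.
  by apply: (err_diag u_lt1 u2_lt1 na (c1 j.+2 _ _) nb (c2 j.+1 _ _)
    (IH j.+2 _ j.+2 _ _) (IH j.+1 _ j.+1 _ _) safe); lia.
rewrite /= (negPf neq_ij) char_coef_rec => [safe|]; last by lia.
by apply: (err_step u_lt1 u2_lt1 (c1 j.+3 _ _) na (c1 j.+2 _ _) nb
  (c2 j.+1 _ _) (IH i.+1 _ j.+3 _ _) (IH i.+1 _ j.+2 _ _)
  (IH i _ j.+1 _ _) safe); lia.
Qed.

End LaBudde.

(** * Transfer to the given symmetric matrix *)

Lemma tridiagonal_jacobi_mx (R : realType) n (T : 'M[R]_n)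
    (alpha beta : nat -> R) :
  T^T = T -> tridiagonal T ->
  (forall i : 'I_n, T i i = alpha i.+1) ->
  (forall i j : 'I_n, j = i.+1 :> nat -> T i j = beta j.+1) ->
  T = jacobi_mx alpha beta n.
Proof.
move=> T_sym T_tridiag T_alpha T_beta; apply/matrixP=> i j; rewrite mxE.
have [/val_inj-> //|neq_ij] := eqVneq (val i) (val j).
case: eqP => [/T_beta //|neq_j]; case: eqP => [eq_i|neq_i].
  (* Subdiagonal entries are reached by symmetry. *)
  by rewrite -T_sym mxE T_beta.
by apply: T_tridiag; move: neq_ij => /=; lia.
Qed.

Theorem corollary4p5 (R : realType) (A : fparith R) (n k : nat)
    (T : 'M[R]_n) (alpha beta : nat -> R)
    (T_sym : T^T = T)
    (T_tridiag : tridiagonal T)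
    (T_alpha : forall i : 'I_n, T i i = alpha i.+1)
    (T_beta : forall i j : 'I_n, j = i.+1 :> nat -> T i j = beta j.+1)
    (k_range : (1 <= k <= n)%N)
    (T_normalized : forall i j : 'I_n, normalized A (T i j))
    (nu_lt1 : n%:R * roundoff A < 1)
    (no_exc : labudde_safe A alpha beta n k) :
  forall j : nat, (1 <= j <= k)%N ->
    `|chat A alpha beta n j - (char_poly T)`_(n - j)| <= phi A alpha beta n j.
Proof.
have TE := tridiagonal_jacobi_mx T_sym T_tridiag T_alpha T_beta.
have alpha_normalized i : (0 < i <= n)%N -> normalized A (alpha i).
  case: i => // i /= lt_in.
  by rewrite -(T_alpha (Ordinal lt_in)).
have beta_normalized i : (1 < i <= n)%N -> normalized A (beta i).
  case: i => [|[|i]] // /= lt_in.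
  by rewrite -(T_beta (Ordinal (ltnW lt_in)) (Ordinal lt_in)).
move=> j /andP[j_gt0 le_jk]; rewrite TE.
apply: (chat_err alpha_normalized beta_normalized nu_lt1 no_exc); first lia.
by lia.
Qed.
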